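(* Let $\star$ be a nontrivial semistar operation of an integral domain $D$, let $\tilde{\star} := (\star_f)_{sp}$, and let $\dot{\tilde{\star}}$ be the semistar operation of $D^{\tilde{\star}}$ defined by $E^{\dot{\tilde{\star}}} := E^{\tilde{\star}}$ for each nonzero $D^{\tilde{\star}}$-submodule $E$ of $K$. Then: (1) $(\tilde{\star})_f = \tilde{\star} = (\tilde{\star})_{sp} = \tilde{\tilde{\star}}$. (2) $\mathcal{M}(\star_f) = \mathcal{M}(\tilde{\star})$. (3) $\mathrm{Na}(D,\star) = \mathrm{Na}(D,\tilde{\star}) = \mathrm{Na}(D^{\tilde{\star}}, \dot{\tilde{\star}})$.
   Context: $D$ is an integral domain with quotient field $K$. $\overline{\boldsymbol{F}}(D)$ is the set of nonzero $D$-submodules of $K$, and $\boldsymbol{f}(D)$ the set of nonzero finitely generated $D$-submodules of $K$. A semistar operation of $D$ is a map $\star : \overline{\boldsymbol{F}}(D) \to \overline{\boldsymbol{F}}(D)$, $E \mapsto E^\star$, such that for all $0 \neq z \in K$ and all $E, F \in \overline{\boldsymbol{F}}(D)$: $(zE)^\star = zE^\star$; $E \subseteq F \Rightarrow E^\star \subseteq F^\star$; $E \subseteq E^\star$ and $(E^\star)^\star = E^\star$. It is trivial if $E^\star = K$ for all $E$ (equivalently $D^\star = K$), and nontrivial otherwise. $E^{\star_f} := \bigcup\{F^\star \mid F \subseteq E,\ F \in \boldsymbol{f}(D)\}$; $\star$ is of finite type if $\star=\star_f$. For a semistar operation $\ast$, a quasi-$\ast$-ideal of $D$ is a nonzero ideal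 $I \subseteq D$ with $I^\ast \cap D = I$; a quasi-$\ast$-maximal ideal is a maximal element of the set of all proper quasi-$\ast$-ideals of $D$. For $\ast$ of finite type, $\mathcal{M}(\ast)$ denotes the set of quasi-$\ast$-maximal ideals of $D$. For a semistar operation $\ast$, $\Pi^\ast := \{P \in \mathrm{Spec}(D) \mid P \neq 0,\ P^\ast \cap D \neq D\}$, and if $\Pi^\ast \neq \emptyset$, $\ast_{sp}$ is the semistar operation $E^{\ast_{sp}} := \bigcap\{ED_P \mid P \in \Pi^\ast\}$. For a nontrivial semistar operation $\ast$, $\Pi^{\ast_f}$ is nonempty and $\tilde{\ast} := (\ast_f)_{sp}$, which is again nontrivial; $\tilde{\tilde{\star}}$ is this construction applied to $\tilde{\star}$. $D^{\tilde{\star}}$ is an overring of $D$ in $K$. $\boldsymbol{c}(h)$ is the ideal generated by the coefficients of a polynomial $h$ (in the coefficient ring under consideration). For a semistar operation $\ast$ of a domain $R$ with quotient field $K$, $\mathrm{Na}(R,\ast) := \{f/g \mid f,g \in R[X],\ g \neq 0,\ \boldsymbol{c}(g)^\ast = R^\ast\} \subseteq K(X)$. *)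

(* Defs.v *)
From mathcomp Require Export all_boot all_order all_algebra.
From mathcomp Require Export boolp classical_sets.

Set Implicit Arguments.
Unset Strict Implicit.
Unset Printing Implicit Defensive.

Import GRing.Theory.
Local Open Scope classical_set_scope.
Local Open Scope ring_scope.

(* Lets a structure that coerces to a set also be applied: D x, E x. *)
Identity Coercion set_Funclass : set >-> Funclass.

(* An integral domain with quotient field K is a subring of K every element
   of K is a fraction of. This makes the overrings of D in K, which have the
   same quotient field, objects of the same type. *)
Record subdomain (K : fieldType) := Subdomain {
  dom_set :> set K;
  dom_subring : subring_closed [in dom_set];
  dom_frac : forall x : K, exists a b : K,
    [/\ dom_set a, dom_set b, b != 0 & x = a / b] }.

(* Finite sums of products a * b with a in A and b in B. For B = D this is
   the D-submodule generated by A; for submodules A and B it is their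
   product. *)
Definition setmul (K : fieldType) (A B : set K) : set K :=
  [set x | exists2 s : seq (K * K),
     (forall p, p \in s -> A p.1 /\ B p.2) & x = \sum_(p <- s) p.1 * p.2].

(* A nonzero D-submodule of K. *)
Record fbar (K : fieldType) (D : subdomain K) := Fbar {
  fbar_set :> set K;
  fbarD : forall x y, fbar_set x -> fbar_set y -> fbar_set (x + y);
  fbarM : forall d x, D d -> fbar_set x -> fbar_set (d * x);
  fbar_neq0 : exists2 x, fbar_set x & x != 0 }.

Section Basics.
Variables (K : fieldType) (D : subdomain K).
Implicit Types (E F G H P : fbar D) (A B L : set K).

Lemma dom1 : D 1.
Proof. by have [+ _ _] := dom_subring D; rewrite inE. Qed.

Lemma domB x y : D x -> D y -> D (x - y).
Proof.
have [_ H _] := dom_subring D => Dx Dy.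
by have := H x y; rewrite !inE; apply.
Qed.

Lemma domM x y : D x -> D y -> D (x * y).
Proof.
have [_ _ H] := dom_subring D => Dx Dy.
by have := H x y; rewrite !inE; apply.
Qed.

Lemma dom0 : D 0. Proof. by rewrite -(subrr 1); apply: domB; apply: dom1. Qed.

Lemma domN x : D x -> D (- x).
Proof. by move=> Dx; rewrite -sub0r; apply: domB => //; apply: dom0. Qed.

Lemma domD x y : D x -> D y -> D (x + y).
Proof. by move=> Dx Dy; rewrite -(opprK y); apply: domB => //; apply: domN. Qed.

Lemma fbarP E F : E = F :> set K -> E = F.
Proof.
case: E F => E ED EM E0 [F FD FM F0] /= EF; subst F.
by congr Fbar; apply: Prop_irrelevance.
Qed.

Lemma fbar0 E : E 0.
Proof.
have [x Ex _] := fbar_neq0 E.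
by rewrite -(mul0r x); apply: fbarM => //; apply: dom0.
Qed.

Lemma fbar_sum E (I : eqType) (s : seq I) (f : I -> K) :
  (forall i, i \in s -> E (f i)) -> E (\sum_(i <- s) f i).
Proof.
move=> H; rewrite big_seq; apply: (big_ind (fun x => E x)).
- exact: fbar0.
- exact: fbarD.
- exact: H.
Qed.

Lemma setmul_mem A B x y : A x -> B y -> setmul A B (x * y).
Proof.
move=> Ax By; exists [:: (x, y)]; last by rewrite big_seq1.
by move=> p; rewrite inE => /eqP ->.
Qed.

Lemma setmulD A B x y : setmul A B x -> setmul A B y -> setmul A B (x + y).
Proof.
move=> [s Hs ->] [t Ht ->]; exists (s ++ t); last by rewrite big_cat.
by move=> p; rewrite mem_cat => /orP[/Hs|/Ht].
Qed.

Lemma setmul0 A B : setmul A B 0.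
Proof. by exists [::]; rewrite ?big_nil. Qed.

Lemma setmulMl A B d x : (forall a, A a -> A (d * a)) ->
  setmul A B x -> setmul A B (d * x).
Proof.
move=> H [s Hs ->]; exists [seq (d * p.1, p.2) | p <- s].
  by move=> _ /mapP[p /Hs[Ap Bp] ->] /=; split => //; apply: H.
by rewrite big_map mulr_sumr; apply: eq_bigr => p _; rewrite mulrA.
Qed.

Lemma setmulMr A B d x : (forall b, B b -> B (d * b)) ->
  setmul A B x -> setmul A B (d * x).
Proof.
move=> H [s Hs ->]; exists [seq (p.1, d * p.2) | p <- s].
  by move=> _ /mapP[p /Hs[Ap Bp] ->] /=; split => //; apply: H.
by rewrite big_map mulr_sumr; apply: eq_bigr => p _; rewrite mulrCA.
Qed.

Lemma setmul_sub A B A' B' : A `<=` A' -> B `<=` B' ->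
  setmul A B `<=` setmul A' B'.
Proof.
move=> AA BB x [s Hs ->]; exists s => // p /Hs[Ap Bp].
by split; [apply: AA|apply: BB].
Qed.

Lemma span_min A E : A `<=` E -> setmul A D `<=` E.
Proof.
move=> AE _ [s Hs ->]; apply: fbar_sum => p /Hs[/AE Ep Dp].
by rewrite mulrC; apply: fbarM.
Qed.

Lemma sub_span A : A `<=` setmul A D.
Proof. by move=> a Aa; rewrite -[a]mulr1; apply: setmul_mem => //; apply: dom1. Qed.

Lemma spanM A d x : D d -> setmul A D x -> setmul A D (d * x).
Proof. by move=> Dd; apply: setmulMr => b; apply: domM. Qed.

End Basics.

Section Modules.
Variables (K : fieldType) (D : subdomain K).
Implicit Types (E F G H P : fbar D) (A B L : set K).

Lemma dom_neq0 : exists2 x, D x & x != 0.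
Proof. by exists 1; [exact: dom1|exact: oner_neq0]. Qed.

Definition fbar_dom : fbar D := Fbar (@domD K D) (@domM K D) dom_neq0.

Definition scale_set (z : K) (A : set K) : set K := [set z * x | x in A].

Section Scale.
Variables (z : K) (z0 : z != 0) (E : fbar D).

Lemma scale_closedD x y :
  scale_set z E x -> scale_set z E y -> scale_set z E (x + y).
Proof.
move=> [a Ea <-] [b Eb <-]; exists (a + b); first exact: fbarD.
by rewrite mulrDr.
Qed.

Lemma scale_closedM d x : D d -> scale_set z E x -> scale_set z E (d * x).
Proof.
move=> Dd [a Ea <-]; exists (d * a); first exact: fbarM.
by rewrite mulrCA.
Qed.

Lemma scale_closed_neq0 : exists2 x, scale_set z E x & x != 0.
Proof.
have [x Ex x0] := fbar_neq0 E; exists (z * x); first by exists x.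
by rewrite mulf_neq0.
Qed.

Definition fbar_scale : fbar D :=
  Fbar scale_closedD scale_closedM scale_closed_neq0.

End Scale.

Definition fin_gen (E : fbar D) : Prop :=
  exists s : seq K, E = setmul [set` s] D :> set K.

End Modules.

Arguments fbar_dom {K} D.

Record semistar (K : fieldType) (D : subdomain K) := Semistar {
  semistar_fun :> fbar D -> fbar D;
  semistarZ : forall (z : K) (z0 : z != 0) (E : fbar D),
    semistar_fun (fbar_scale z0 E) = fbar_scale z0 (semistar_fun E);
  semistarS : forall E F : fbar D,
    E `<=` F -> semistar_fun E `<=` semistar_fun F;
  semistar_ext : forall E : fbar D, E `<=` semistar_fun E;
  semistar_idem : forall E : fbar D,
    semistar_fun (semistar_fun E) = semistar_fun E }.

Lemma semistarP (K : fieldType) (D : subdomain K) (s t : semistar D) :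
  (forall E : fbar D, s E = t E :> set K) -> s = t.
Proof.
case: s t => s s1 s2 s3 s4 [t t1 t2 t3 t4] /= st.
have {}st : s = t by apply/funext => E; apply: fbarP.
by subst t; congr Semistar; apply: Prop_irrelevance.
Qed.

Definition trivial_semistar (K : fieldType) (D : subdomain K)
  (star : semistar D) : Prop := forall E : fbar D, star E = setT :> set K.

Definition nontrivial (K : fieldType) (D : subdomain K)
  (star : semistar D) : Prop := ~ trivial_semistar star.

Section Build.
Variables (K : fieldType) (D : subdomain K) (f : fbar D -> fbar D).
Hypothesis fZ : forall (z : K) (z0 : z != 0) (E : fbar D) x,
  f E x -> f (fbar_scale z0 E) (z * x).
Hypothesis fS : forall E F : fbar D, E `<=` F -> f E `<=` f F.
Hypothesis fE : forall E : fbar D, E `<=` f E.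
Hypothesis fI : forall E : fbar D, f (f E) `<=` f E.

Lemma buildZ (z : K) (z0 : z != 0) (E : fbar D) :
  f (fbar_scale z0 E) = fbar_scale z0 (f E).
Proof.
apply: fbarP; apply/seteqP; split => x; last by move=> [y fy <-]; apply: fZ.
have zV : z^-1 != 0 by rewrite invr_neq0.
move=> /(fZ zV) H; exists (z^-1 * x); last by rewrite mulVKf.
apply: fS H => _ [_ [y Ey <-] <-]; by rewrite mulKf.
Qed.

Lemma build_idem (E : fbar D) : f (f E) = f E.
Proof. by apply: fbarP; apply/seteqP; split; [apply: fI|apply: fE]. Qed.

(* For a monotone, extensive f, inclusions suffice in the other axioms. *)
Definition semistar_build : semistar D := Semistar buildZ fS fE build_idem.

End Build.

Section FiniteType.
Variables (K : fieldType) (D : subdomain K) (star : semistar D).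
Implicit Types E F G H : fbar D.

Definition fin_set (E : fbar D) : set K :=
  \bigcup_(F in [set F : fbar D | fin_gen F /\ F `<=` E]) star F.

Lemma span_seqD (s : seq K) x y :
  setmul [set` s] D x -> setmul [set` s] D y -> setmul [set` s] D (x + y).
Proof. exact: setmulD. Qed.

Lemma fin_gen_cat E F (s t : seq K) :
    E = setmul [set` s] D :> set K -> F = setmul [set` t] D :> set K ->
  exists G, [/\ G = setmul [set` s ++ t] D :> set K, E `<=` G, F `<=` G &
    forall H : fbar D, E `<=` H -> F `<=` H -> G `<=` H].
Proof.
move=> Es Ft.
have sE : E `<=` setmul [set` s ++ t] D.
  rewrite Es; apply: setmul_sub => // x /=; by rewrite mem_cat => ->.
have tF : F `<=` setmul [set` s ++ t] D.
  rewrite Ft; apply: setmul_sub => // x /=; by rewrite mem_cat orbC => ->.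
have nz : exists2 x, setmul [set` s ++ t] D x & x != 0.
  by have [x /sE Ex x0] := fbar_neq0 E; exists x.
exists (Fbar (@span_seqD (s ++ t)) (@spanM K D _) nz); split => //= H EH FH.
apply: span_min => x /=; rewrite mem_cat => /orP[xs|xt].
  by apply: EH; rewrite Es; apply: sub_span.
by apply: FH; rewrite Ft; apply: sub_span.
Qed.

Lemma fin_dir E F G : fin_gen F -> F `<=` E -> fin_gen G -> G `<=` E ->
  exists H, [/\ fin_gen H, H `<=` E, F `<=` H & G `<=` H].
Proof.
move=> [s Fs] FE [t Gt] GE.
have [H [Hst FH GH Hm]] := fin_gen_cat Fs Gt.
by exists H; split => //; [exists (s ++ t)|apply: Hm].
Qed.

Lemma fin_gen1 x : x != 0 ->
  exists F, [/\ fin_gen F, F x & forall E, E x -> F `<=` E].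
Proof.
move=> x0.
have sx : setmul [set` [:: x]] D x by apply: sub_span; rewrite /= mem_head.
exists (Fbar (@span_seqD [:: x]) (@spanM K D _) (ex_intro2 _ _ x sx x0)).
split=> //=; first by exists [:: x].
by move=> E Ex; apply: span_min => y /=; rewrite inE => /eqP ->.
Qed.

Lemma fin_set_ext E : E `<=` fin_set E.
Proof.
move=> x Ex.
have [x0|x0] := eqVneq x 0; last first.
  have [F [Ff Fx Fm]] := fin_gen1 x0.
  by exists F; [split => //; apply: Fm|apply: semistar_ext].
have [y Ey y0] := fbar_neq0 E.
have [F [Ff Fx Fm]] := fin_gen1 y0.
by exists F; [split => //; apply: Fm|rewrite x0; apply: fbar0].
Qed.

Lemma fin_setD E x y : fin_set E x -> fin_set E y -> fin_set E (x + y).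
Proof.
move=> [F [Ff FE] Fx] [G [Gf GE] Gy].
have [H [Hf HE FH GH]] := fin_dir Ff FE Gf GE.
exists H => //; apply: fbarD.
  exact: (semistarS FH Fx).
exact: (semistarS GH Gy).
Qed.

Lemma fin_setM E d x : D d -> fin_set E x -> fin_set E (d * x).
Proof. by move=> Dd [F FE Fx]; exists F => //; apply: fbarM. Qed.

Lemma fin_set_neq0 E : exists2 x, fin_set E x & x != 0.
Proof.
by have [x Ex x0] := fbar_neq0 E; exists x => //; apply: fin_set_ext.
Qed.

Definition fin_fun (E : fbar D) : fbar D :=
  Fbar (@fin_setD E) (@fin_setM E) (fin_set_neq0 E).

Lemma fin_funZ (z : K) (z0 : z != 0) E x :
  fin_fun E x -> fin_fun (fbar_scale z0 E) (z * x).
Proof.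
move=> [F [[s Fs] FE] Fx]; exists (fbar_scale z0 F).
  split; last by move=> _ [y /FE Fy <-]; exists y.
  exists [seq z * a | a <- s] => /=; rewrite Fs; apply/seteqP; split.
    move=> _ [_ [r Hr ->] <-]; exists [seq (z * p.1, p.2) | p <- r].
      by move=> _ /mapP[p /Hr[ps Dp] ->] /=; split => //; apply: map_f.
    by rewrite big_map mulr_sumr; apply: eq_bigr => p _; rewrite mulrA.
  rewrite -Fs; apply: (@span_min K D _ (fbar_scale z0 F)).
  move=> _ /= /mapP[a sa ->]; exists a => //.
  by rewrite Fs; apply: sub_span.
by rewrite semistarZ; exists x.
Qed.

Lemma fin_funS E F : E `<=` F -> fin_fun E `<=` fin_fun F.
Proof.
move=> EF x [G [Gf GE] Gx]; exists G => //.
by split => //; apply: subset_trans EF.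
Qed.

Lemma fin_fun_seq E (s : seq K) : [set` s] `<=` fin_fun E ->
  exists2 G, fin_gen G /\ G `<=` E & [set` s] `<=` star G.
Proof.
elim: s => [|a s IH] H.
  have [x Ex x0] := fbar_neq0 E.
  have [F [Ff _ Fm]] := fin_gen1 x0.
  by exists F => //; split => //; apply: Fm.
have [|G [Gf GE] sG] := IH.
  by move=> x xs; apply: H; rewrite /= inE (xs : x \in s) orbT.
have [|F [Ff FE] Fa] := H a; first by rewrite /= mem_head.
have [J [Jf JE GJ FJ]] := fin_dir Gf GE Ff FE.
exists J => // x /=; rewrite inE => /orP[/eqP ->|xs].
  exact: (semistarS FJ Fa).
by apply: (semistarS GJ); apply: sG.
Qed.

Lemma fin_fun_idem E : fin_fun (fin_fun E) `<=` fin_fun E.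
Proof.
move=> x [F [[s Fs] FE] Fx].
have [|G GE sG] := @fin_fun_seq E s.
  by move=> y ys; apply: FE; rewrite Fs; apply: sub_span.
exists G => //; rewrite -semistar_idem.
by apply: semistarS Fx; rewrite Fs; apply: span_min.
Qed.

Definition star_fin : semistar D :=
  semistar_build fin_funZ fin_funS fin_set_ext fin_fun_idem.

End FiniteType.

Section Spectral.
Variables (K : fieldType) (D : subdomain K).
Implicit Types (E F P : fbar D).

Definition is_ideal (I : fbar D) : Prop := I `<=` D.

Definition prime_ideal (P : fbar D) : Prop :=
  [/\ is_ideal P, P <> D :> set K &
      forall a b, D a -> D b -> P (a * b) -> P a \/ P b].

Definition localization (P : fbar D) : set K :=
  [set x | exists a s, [/\ D a, D s, ~ P s & x = a / s]].

Definition Pi (star : semistar D) : set (fbar D) :=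
  [set P | prime_ideal P /\ star P `&` D <> D].

Variable star : semistar D.

Lemma localizationM P : prime_ideal P -> forall x y,
  localization P x -> localization P y -> localization P (x * y).
Proof.
move=> [_ _ Pp] _ _ [a [s [Da Ds Ps ->]]] [b [t [Db Dt Pt ->]]].
exists (a * b), (s * t); split; first exact: domM.
- exact: domM.
- by case/(Pp _ _ Ds Dt).
- by rewrite invfM mulrACA.
Qed.

Lemma localization1 P : prime_ideal P -> localization P 1.
Proof.
move=> [PD P1 _]; exists 1, 1; split; rewrite ?divr1 //; try exact: dom1.
move=> P1'; apply: P1; apply/seteqP; split => // x Dx.
by rewrite -[x]mulr1; apply: fbarM.
Qed.

(* If Pi star is empty, the intersection is K and the operation below is
   trivial. *)
Definition sp_set (E : fbar D) : set K :=
  \bigcap_(P in Pi star) setmul E (localization P).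

Lemma sp_set_ext E : E `<=` sp_set E.
Proof.
move=> x Ex P [Pp _]; rewrite -[x]mulr1; apply: setmul_mem => //.
exact: localization1.
Qed.

Lemma sp_setD E x y : sp_set E x -> sp_set E y -> sp_set E (x + y).
Proof.
by move=> Ex Ey P SP; apply: setmulD; [apply: Ex|apply: Ey].
Qed.

Lemma sp_setM E d x : D d -> sp_set E x -> sp_set E (d * x).
Proof.
move=> Dd Ex P SP; apply: setmulMl (Ex _ SP) => a.
exact: fbarM.
Qed.

Lemma sp_set_neq0 E : exists2 x, sp_set E x & x != 0.
Proof. by have [x Ex x0] := fbar_neq0 E; exists x => //; apply: sp_set_ext. Qed.

Definition sp_fun (E : fbar D) : fbar D :=
  Fbar (@sp_setD E) (@sp_setM E) (sp_set_neq0 E).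

Lemma sp_funZ (z : K) (z0 : z != 0) (E : fbar D) x :
  sp_fun E x -> sp_fun (fbar_scale z0 E) (z * x).
Proof.
move=> Ex P SP; have [r Hr ->] := Ex _ SP.
exists [seq (z * p.1, p.2) | p <- r].
  by move=> _ /mapP[p /Hr[Ep Lp] ->] /=; split => //; exists p.1.
by rewrite big_map mulr_sumr; apply: eq_bigr => p _; rewrite mulrA.
Qed.

Lemma sp_funS (E F : fbar D) : E `<=` F -> sp_fun E `<=` sp_fun F.
Proof. by move=> EF x Ex P SP; apply: setmul_sub (Ex _ SP). Qed.

Lemma sp_fun_idem (E : fbar D) : sp_fun (sp_fun E) `<=` sp_fun E.
Proof.
move=> x Ex P SP; have [r Hr ->] := Ex _ SP.
rewrite big_seq; apply: (big_ind (fun y => setmul E (localization P) y)).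
- exact: setmul0.
- by move=> *; apply: setmulD.
- move=> p /Hr[Ep Lp]; rewrite mulrC; apply: setmulMr (Ep _ SP).
  by move=> b; apply: localizationM Lp; case: SP.
Qed.

Definition star_sp : semistar D :=
  semistar_build sp_funZ sp_funS sp_set_ext sp_fun_idem.

End Spectral.

Definition star_tilde (K : fieldType) (D : subdomain K) (star : semistar D) :
  semistar D := star_sp (star_fin star).

Section QuasiIdeals.
Variables (K : fieldType) (D : subdomain K) (star : semistar D).

Definition quasi_ideal (I : fbar D) : Prop :=
  is_ideal I /\ star I `&` D = I.

Definition proper_quasi_ideal (I : fbar D) : Prop :=
  quasi_ideal I /\ I <> D :> set K.

Definition quasi_max : set (fbar D) :=
  [set M | proper_quasi_ideal M /\
     forall J : fbar D, proper_quasi_ideal J -> M `<=` J -> J = M].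

End QuasiIdeals.

Section Overring.
Variables (K : fieldType) (D : subdomain K) (star : semistar D).

Lemma star_module (E : fbar D) d x :
  star (fbar_dom D) d -> star E x -> star E (d * x).
Proof.
move=> Dd Ex; have [->|x0] := eqVneq x 0; first by rewrite mulr0; apply: fbar0.
rewrite -semistar_idem.
have xD : fbar_scale x0 (fbar_dom D) `<=` star E.
  by move=> _ [a Da <-]; rewrite mulrC; apply: fbarM.
by apply: (semistarS xD); rewrite semistarZ; exists d => //; rewrite mulrC.
Qed.

Lemma overring_subring : subring_closed [in (star (fbar_dom D) : set K)].
Proof.
split.
- rewrite inE; apply: semistar_ext; exact: dom1.
- move=> x y; rewrite !inE => Hx Hy; apply: fbarD => //.
  by rewrite -mulN1r; apply: fbarM => //; apply: domN; apply: dom1.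
- by move=> x y; rewrite !inE => Hx Hy; apply: star_module.
Qed.

Lemma overring_frac x : exists a b,
  [/\ star (fbar_dom D) a, star (fbar_dom D) b, b != 0 & x = a / b].
Proof.
have [a [b [Da Db b0 ->]]] := dom_frac D x; exists a, b.
by split => //; apply: semistar_ext.
Qed.

Definition overring : subdomain K := Subdomain overring_subring overring_frac.

Lemma restrictM (E : fbar overring) d x : D d -> E x -> E (d * x).
Proof. by move=> Dd; apply: fbarM; apply: semistar_ext. Qed.

Definition restrict (E : fbar overring) : fbar D :=
  Fbar (@fbarD _ _ E) (@restrictM E) (fbar_neq0 E).

Definition dot_fun (E : fbar overring) : fbar overring :=
  @Fbar K overring (star (restrict E))
    (@fbarD _ _ _) (@star_module _) (fbar_neq0 _).

Lemma dot_funZ (z : K) (z0 : z != 0) (E : fbar overring) x :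
  dot_fun E x -> dot_fun (fbar_scale z0 E) (z * x).
Proof.
move=> Ex; rewrite /= (_ : restrict _ = fbar_scale z0 (restrict E)).
  by rewrite semistarZ; exists x.
exact: fbarP.
Qed.

Lemma dot_funS (E F : fbar overring) : E `<=` F -> dot_fun E `<=` dot_fun F.
Proof. by move=> EF; apply: (@semistarS _ _ star (restrict E) (restrict F)). Qed.

Lemma dot_fun_ext (E : fbar overring) : E `<=` dot_fun E.
Proof. exact: (@semistar_ext _ _ star (restrict E)). Qed.

Lemma dot_fun_idem (E : fbar overring) : dot_fun (dot_fun E) `<=` dot_fun E.
Proof.
rewrite /= (_ : restrict (dot_fun E) = star (restrict E)) ?semistar_idem //.
exact: fbarP.
Qed.

(* E |-> E^star, as a semistar operation of D^star. *)
Definition star_dot : semistar overring :=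
  semistar_build dot_funZ dot_funS dot_fun_ext dot_fun_idem.

End Overring.

Section Nagata.
Variables (K : fieldType) (R : subdomain K).

Section Content.
Variables (h : {poly K}) (h0 : h != 0).

Definition content_set : set K := setmul [set` (h : seq K)] R.

Lemma content_setM d x : R d -> content_set x -> content_set (d * x).
Proof. exact: spanM. Qed.

Lemma content_set_neq0 : exists2 x, content_set x & x != 0.
Proof.
exists (lead_coef h); last by rewrite lead_coef_eq0.
by apply: sub_span; rewrite /= mem_nth // prednK // lt0n size_poly_eq0.
Qed.

Definition content : fbar R :=
  Fbar (@setmulD _ _ _) content_setM content_set_neq0.

End Content.

Definition poly_over (h : {poly K}) : Prop := h \is a polyOver [in (R : set K)].

Definition Na (star : semistar R) : set {fraction {poly K}} :=
  [set q | exists (f g : {poly K}) (g0 : g != 0),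
     [/\ poly_over f, poly_over g,
         star (content g0) = star (fbar_dom R) &
         q = tofrac f / tofrac g]].

End Nagata.

(* Main.v *)
Require Import Defs.

From mathcomp Require Import fraction.

Set Implicit Arguments.
Unset Strict Implicit.
Unset Printing Implicit Defensive.

Import GRing.Theory.
Local Open Scope classical_set_scope.
Local Open Scope ring_scope.

(** Everything depends on [star_fin star] only through the ideals I for which
1 lies in the closure of I; call these the units of the operation. The
spectral operation [star_tilde star] has the same ideals as units, and it is
determined by them.

The link is the colon ideal (E : x) of the d in D with d x in E. Localizing at
a prime P, x lies in E D_P exactly when (E : x) is not contained in P. If x
lies in E D_P for all P in [Pi (star_fin star)], then (E : x) lies in no such
P. By Zorn's lemma, which applies because [star_fin star] has finite type, an
ideal that is not a unit lies in a maximal ideal that is not a unit, and such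
an ideal is prime, hence in [Pi (star_fin star)]. So (E : x) is a unit
([star_tilde_colon]). With E = I and x = 1 this shows that the two operations
have the same units ([star_tilde_unitP]).

(1) Being a unit of [star_fin star] is witnessed by a finitely generated
subideal, which for (E : x) gives finite type of [star_tilde star]. Membership
in [Pi] is a condition on units, so [Pi] and hence the spectral operation do
not change under a second application.

(2) The quasi-maximal ideals of any semistar operation are the maximal ideals
that are not units ([quasi_maxP]).

(3) The content of a polynomial g over D is a finitely generated ideal, and g
is an admissible denominator exactly when this content is a unit; this gives
the first equality. For the second, take f and g over the overring. The ideal
of the d in D that send all coefficients of f and g into D is again a unit, so
it contains a finitely generated H with 1 in the [star]-closure. Multiply f
and g by a polynomial h whose coefficients generate H, so widely spaced that
no two terms of h g overlap. The content of h g over D is then generated by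
the products of the generators of H with the coefficients of g, and it lies in
no P of [Pi (star_fin star)], since neither factor vanishes modulo P. *)

(** * Colon ideals *)

Section Colon.
Variables (K : fieldType) (D : subdomain K).
Implicit Types (E F I J M P : fbar D) (ys : seq K).

Definition colon_set E ys : set K :=
  [set d | D d /\ forall y, y \in ys -> E (d * y)].

Lemma colon_setD E ys a b :
  colon_set E ys a -> colon_set E ys b -> colon_set E ys (a + b).
Proof.
move=> [Da Ha] [Db Hb]; split; first exact: domD.
by move=> y yys; rewrite mulrDl; apply: fbarD; [apply: Ha|apply: Hb].
Qed.

Lemma colon_setM E ys d a : D d -> colon_set E ys a -> colon_set E ys (d * a).
Proof.
move=> Dd [Da Ha]; split; first exact: domM.
by move=> y yys; rewrite -mulrA; apply: fbarM => //; apply: Ha.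
Qed.

(** Finitely many elements of K have a common denominator, even relative to
E. *)
Lemma colon_set_neq0 E ys : exists2 d, colon_set E ys d & d != 0.
Proof.
elim: ys => [|y ys [d [Dd Hd] d0]].
  by exists 1; [split => //; exact: dom1|exact: oner_neq0].
have [e Ee e0] := fbar_neq0 E.
have [a [b [Da Db b0 yab]]] := dom_frac D (y / e).
exists (d * b); last by rewrite mulf_neq0.
split=> [|x]; first exact: domM.
rewrite inE => /orP[/eqP ->|xys]; last first.
  by rewrite mulrAC mulrC; apply: fbarM => //; apply: Hd.
rewrite -(divfK e0 y) yab -mulrA (mulrA b) (mulrCA b) divff // mulr1.
by apply: fbarM => //; apply: fbarM.
Qed.

(** Indexed by a list, so that it also covers common conductors of several
elements; with the list [:: 1] it is the trace of E on D. *)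
Definition colon E ys : fbar D :=
  Fbar (@colon_setD E ys) (@colon_setM E ys) (colon_set_neq0 E ys).

Lemma colon_ideal E ys : is_ideal (colon E ys).
Proof. by move=> d []. Qed.

Lemma colon1P E d : colon E [:: 1] d <-> D d /\ E d.
Proof.
split=> [[Dd /(_ 1)]|[Dd Ed]]; first by rewrite mem_head mulr1 => /(_ isT).
by split=> // y; rewrite inE => /eqP ->; rewrite mulr1.
Qed.

End Colon.

(** * Units and maximal non-units of a semistar operation *)

Section Units.
Variables (K : fieldType) (D : subdomain K).
Implicit Types (E F I J M P : fbar D) (ys : seq K) (star : semistar D).

Lemma star_hull star E F : E `<=` star F -> star E `<=` star F.
Proof. by move=> EF; rewrite -[star F]semistar_idem; apply: semistarS. Qed.

Lemma sub_of_1 E : E 1 -> D `<=` E.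
Proof. by move=> E1 d Dd; rewrite -[d]mulr1; apply: fbarM. Qed.

Lemma star_traceP star I : star I `&` D = D :> set K <-> star I 1.
Proof.
split=> [ID|/sub_of_1 DI]; last by apply/seteqP; split => [x []|x Dx] //; split => //; apply: DI.
by have : D 1 by [exact: dom1]; rewrite -{1}ID => -[].
Qed.

Lemma star_eq_domP star I : is_ideal I -> star I = star (fbar_dom D) <-> star I 1.
Proof.
move=> ID; split=> [->|I1]; first by apply: semistar_ext; exact: dom1.
apply: fbarP; apply/seteqP; split; first exact: semistarS.
by apply: star_hull; exact: sub_of_1.
Qed.

Lemma PiP star P : Pi star P <-> prime_ideal P /\ ~ star P 1.
Proof. by split=> -[Pp P1]; split => // /star_traceP. Qed.

Lemma star_finS star E : star_fin star E `<=` star E.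
Proof. by move=> x [F [_ FE]]; apply: semistarS. Qed.

Lemma star_fin_fg star F : fin_gen F -> star_fin star F = star F.
Proof.
move=> Ff; apply: fbarP; apply/seteqP; split; first exact: star_finS.
by move=> x Fx; exists F => //; split.
Qed.

(** For the identity operation these are the nonzero maximal ideals of D. *)
Definition maximal_nonunit star M : Prop :=
  [/\ is_ideal M, ~ star M 1 &
    forall J, is_ideal J -> ~ star J 1 -> M `<=` J -> J = M].

(** The trace of the closure of M has the same closure as M, so it is a
non-unit containing M. *)
Lemma maximal_nonunit_closed star M :
  maximal_nonunit star M -> star M `&` D `<=` M.
Proof.
move=> [MD M1 Mmax] x [Mx Dx].
suff <- : colon (star M) [:: 1] = M by apply/colon1P.
apply: Mmax; first exact: colon_ideal.
- by move=> H; apply: M1; apply: star_hull H => y /colon1P[].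
- by move=> y My; apply/colon1P; split; [apply: MD|apply: semistar_ext].
Qed.

(** Let a b be in M and b not. The ideal (M : b) contains M and a. If it were a
unit, then b would lie in the closure of b (M : b), which is contained in M;
so (M : b) = M by maximality. *)
Lemma maximal_nonunit_prime star M : maximal_nonunit star M -> prime_ideal M.
Proof.
move=> Mm; have [MD M1 Mmax] := Mm; split=> //.
  by move=> MeD; apply: M1; apply: semistar_ext; rewrite MeD; exact: dom1.
move=> a b Da Db Mab; have [Mb|Mb] := EM (M b); [by right|left].
have b0 : b != 0 by apply: contra_not_neq Mb => ->; exact: fbar0.
suff <- : colon M [:: b] = M.
  by split=> // y; rewrite inE => /eqP ->.
apply: Mmax; first exact: colon_ideal.
- move=> J1; apply: Mb; apply: (maximal_nonunit_closed Mm); split=> //.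
  have bJ : fbar_scale b0 (colon M [:: b]) `<=` M.
    by move=> _ [d [_ /(_ b)] + <-]; rewrite mem_head mulrC; apply.
  by apply: (semistarS bJ); rewrite semistarZ; exists 1; rewrite ?mulr1.
- move=> m Mm'; split; first exact: MD.
  by move=> y; rewrite inE => /eqP ->; rewrite mulrC; apply: fbarM.
Qed.

(** For an ideal I that is not a unit, the trace of [star I] on D is a proper
quasi-ideal above I; hence maximality among proper quasi-ideals and among
non-units agree, and quasi-maximality depends on the units alone. *)
Lemma quasi_maxP star M : quasi_max star M <-> maximal_nonunit star M.
Proof.
have properP I : is_ideal I -> proper_quasi_ideal star I -> ~ star I 1.
  by move=> ID [[_ qI] nI] /star_traceP I1; apply: nI; rewrite -qI.
have closedP I : is_ideal I -> ~ star I 1 -> star I `&` D `<=` I ->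
    proper_quasi_ideal star I.
  move=> ID I1 cI; split; last first.
    by move=> IeD; apply: I1; apply: semistar_ext; rewrite IeD; exact: dom1.
  split=> //; apply/seteqP; split=> // x Ix.
  by split; [apply: semistar_ext|apply: ID].
split=> [[Mq Mmax]|Mm].
  have MD : is_ideal M by case: Mq => -[].
  split=> [//||J JD J1 MJ]; first exact: properP.
  have J'M : colon (star J) [:: 1] = M.
    apply: Mmax => [|x Mx]; last first.
      by apply/colon1P; split; [apply: MD|apply/semistar_ext/MJ].
    have J'J : star (colon (star J) [:: 1]) `<=` star J.
      by apply: star_hull => x /colon1P[].
    apply: closedP; [exact: colon_ideal|by move=> /J'J|].
    by move=> x [/J'J Jx Dx]; apply/colon1P.
  apply: fbarP; apply/seteqP; split=> // x Jx; rewrite -J'M.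
  by apply/colon1P; split; [apply: JD|apply: semistar_ext].
have [MD M1 Mmax] := Mm; split.
  by apply: closedP => //; exact: maximal_nonunit_closed.
move=> J Jq; have JD : is_ideal J by case: Jq => -[].
by apply: Mmax => //; exact: properP.
Qed.

(** Asking for a member above X0 makes the member found nonempty as soon as X0
is, even for the empty list. *)
Lemma chain_seq (C : set (set K)) (X0 : set K) (s : seq K) :
    C X0 -> total_on C subset -> [set` s] `<=` \bigcup_(X in C) X ->
  exists2 X, C X & X0 `|` [set` s] `<=` X.
Proof.
move=> CX0 Ct; elim: s => [|a s IH] sC.
  by exists X0 => // x [].
have [|X CX sX] := IH; first by move=> x xs; apply: sC; rewrite /= inE (xs : x \in s) orbT.
have [|Y CY Ya] := sC a; first by rewrite /= mem_head.
have [XY|YX] := Ct X Y CX CY; [exists Y|exists X] => // x [X0x|/=].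
- by apply: XY; apply: sX; left.
- by rewrite inE => /orP[/eqP ->//|xs]; apply: XY; apply: sX; right.
- by apply: sX; left.
- by rewrite inE => /orP[/eqP ->|xs]; [exact: YX|apply: sX; right].
Qed.

(** The union of a chain of non-units is a non-unit, because a finitely
generated witness would already lie in one member. *)
Lemma ex_maximal_nonunit star I : is_ideal I -> ~ star_fin star I 1 ->
  exists2 M, maximal_nonunit (star_fin star) M & I `<=` M.
Proof.
move=> ID I1.
pose good (J : fbar D) := [/\ is_ideal J, ~ star_fin star J 1 & I `<=` J].
(* The empty set is admitted because it is the union of the empty chain. *)
pose Q (A : set K) := A = set0 \/ exists2 J : fbar D, A = J & good J.
have [C CQ Ct|A [QA Amax]] := @Zorn_bigcup K Q.
  have [[X0 CX0 [x0 X0x0]]|noX] := EM (exists2 X, C X & X !=set0); last first.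
    left; apply/seteqP; split=> // x [X CX Xx]; apply: noX.
    by exists X => //; exists x.
  have up (s : seq K) : [set` s] `<=` \bigcup_(X in C) X ->
      exists J : fbar D, [/\ C J, good J & [set` s] `<=` J].
    move=> /(chain_seq CX0 Ct)[X CX sX].
    have Xx0 : X x0 by apply: sX; left.
    have [X_0|[J XJ gJ]] := CQ _ CX; first by rewrite X_0 in Xx0.
    by exists J; rewrite -XJ; split=> // x xs; apply: sX; right.
  have [|J0 [CJ0 [_ _ IJ0] _]] := up [::]; first by [].
  have UD x y : (\bigcup_(X in C) X) x -> (\bigcup_(X in C) X) y ->
      (\bigcup_(X in C) X) (x + y).
    move=> Ux Uy; have [|J [CJ _ sJ]] := up [:: x; y].
      by move=> z; rewrite /= !inE => /orP[]/eqP->.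
    by exists J => //; apply: fbarD; apply: sJ; rewrite /= !inE eqxx ?orbT.
  have UM d x : D d -> (\bigcup_(X in C) X) x -> (\bigcup_(X in C) X) (d * x).
    move=> Dd Ux; have [|J [CJ _ sJ]] := up [:: x].
      by move=> z; rewrite /= !inE => /eqP->.
    by exists J => //; apply: fbarM => //; apply: sJ; rewrite /= inE.
  have IU : I `<=` \bigcup_(X in C) X by move=> x /IJ0; exists J0.
  have U0 : exists2 x, (\bigcup_(X in C) X) x & x != 0.
    by have [x /IU Ux x_0] := fbar_neq0 I; exists x.
  right; exists (Fbar UD UM U0) => //; split=> //=.
    move=> x Ux; have [|J [_ [JD _ _] sJ]] := up [:: x].
      by move=> z; rewrite /= !inE => /eqP->.
    by apply: JD; apply: sJ; rewrite /= inE.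
  move=> [F [[s Fs] FU] F1].
  have [|J [_ [_ J1 _] sJ]] := up s.
    by move=> x xs; apply: FU; rewrite Fs; apply: sub_span.
  apply: J1; exists F => //; split; first by exists s.
  by rewrite Fs; apply: span_min.
case: QA => [A0|[M AM [MD M1 IM]]].
  have [x Ix _] := fbar_neq0 I.
  case: (Amax I); first by rewrite A0; split=> // /(_ x Ix).
  by right; exists I => //; split.
exists M => //; split=> // J JD J1 MJ; apply: fbarP; apply/seteqP; split=> //.
apply: contrapT => nJM; apply: (Amax J); first by rewrite AM; split.
by right; exists J => //; split=> //; apply: subset_trans MJ.
Qed.

(** A semistar form of the fact that an ideal contained in no maximal ideal is
the whole ring. *)
Lemma star_fin_unit star I : is_ideal I ->
  (forall P, Pi (star_fin star) P -> ~ I `<=` P) -> star_fin star I 1.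
Proof.
move=> ID HI; apply: contrapT => I1.
have [M Mm IM] := ex_maximal_nonunit ID I1.
apply: (HI M) => //; apply/PiP; split; last by case: Mm.
exact: maximal_nonunit_prime Mm.
Qed.

End Units.

(** * The operation star_tilde *)

Section Tilde.
Variables (K : fieldType) (D : subdomain K).
Implicit Types (E F I J M P : fbar D) (ys : seq K) (star : semistar D).

Lemma prime_not1 P : prime_ideal P -> ~ P 1.
Proof.
by move=> [PD PnD _] P1; apply: PnD; apply/seteqP; split=> //; exact: sub_of_1.
Qed.

(** Finitely many fractions have a common denominator outside P. *)
Lemma setmul_localizationP P E x : prime_ideal P ->
  setmul E (localization P) x <-> exists s, [/\ D s, ~ P s & E (s * x)].
Proof.
move=> Pp; have [_ _ PM] := Pp; split=> [[r Hr ->]|[s [Ds Ps Esx]]].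
  rewrite big_seq; apply: (big_ind (fun y => exists s, [/\ D s, ~ P s & E (s * y)])).
  - exists 1; rewrite mulr0; split; [exact: dom1|exact: prime_not1|exact: fbar0].
  - move=> y z [s [Ds Ps Es]] [t [Dt Pt Et]]; exists (s * t); split.
    + exact: domM.
    + by case/(PM _ _ Ds Dt).
    + rewrite mulrDr; apply: fbarD; last by rewrite -mulrA; apply: fbarM.
      by rewrite (mulrC s) -mulrA; apply: fbarM.
  - move=> p /Hr[Ep [a [s [Da Ds Ps ->]]]]; exists s; split=> //.
    have s0 : s != 0 by apply: contra_not_neq Ps => ->; exact: fbar0.
    by rewrite mulrCA mulrC (mulrC s) divfK //; apply: fbarM.
have s0 : s != 0 by apply: contra_not_neq Ps => ->; exact: fbar0.
have -> : x = (s * x) * s^-1 by rewrite mulrAC divff // mul1r.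
apply: setmul_mem => //; exists 1, s; split=> //; first exact: dom1.
by rewrite div1r.
Qed.

(** Multiplying denominators outside P, one for each element of the list,
stays outside P. *)
Lemma colon_not_sub P E ys : prime_ideal P ->
  (forall y, y \in ys -> setmul E (localization P) y) -> ~ colon E ys `<=` P.
Proof.
move=> Pp Hys; have [_ _ PM] := Pp.
suff [s [Cs Ps]] : exists s, colon E ys s /\ ~ P s by move=> /(_ s Cs).
elim: ys Hys => [|y ys IH] Hys.
  by exists 1; split; [split=> //; exact: dom1|exact: prime_not1].
have [|s [[Ds Es] Ps]] := IH.
  by move=> z zys; apply: Hys; rewrite inE zys orbT.
have /setmul_localizationP[//|t [Dt Pt Et]] := Hys y (mem_head _ _).
exists (s * t); split; last by case/(PM _ _ Ds Dt).
split=> [|z]; first exact: domM.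
rewrite inE => /orP[/eqP ->|zys]; first by rewrite -mulrA; apply: fbarM.
by rewrite (mulrC s) -mulrA; apply: fbarM => //; apply: Es.
Qed.

(** The way back from the local definition to a global witness: unfolding
[star_fin], a finitely generated ideal with 1 in its [star]-closure
multiplies all the elements of the list into E. *)
Lemma star_tilde_colon star E ys :
  (forall y, y \in ys -> star_tilde star E y) -> star_fin star (colon E ys) 1.
Proof.
move=> Hys; apply: star_fin_unit; first exact: colon_ideal.
by move=> P SP; apply: colon_not_sub => [|y /Hys]; [case: SP|apply].
Qed.

Lemma star_tilde_unitP star I : is_ideal I ->
  star_tilde star I 1 <-> star_fin star I 1.
Proof.
move=> ID; split=> [I1|I1 P SP].
  have : star_fin star (colon I [:: 1]) 1.
    by apply: star_tilde_colon => y; rewrite inE => /eqP ->.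
  by apply: semistarS => x /colon1P[].
have /PiP[Pp P1] := SP.
have /existsNP[s /not_implyP[Is Ps]] : ~ I `<=` P.
  by move=> IP; apply: P1; apply: semistarS I1.
by apply/setmul_localizationP => //; exists s; rewrite mulr1; split=> //; apply: ID.
Qed.

(** If x lies in [star_tilde star E], then a finitely generated F inside
(E : x) is a unit of [star_tilde star], and x lies in the closure of x F,
which is a finitely generated submodule of E. The proof runs this through
homogeneity, as an inclusion x (E : x) in E. *)
Lemma star_tilde_fin_type star : star_fin (star_tilde star) = star_tilde star.
Proof.
apply: semistarP => E; apply/seteqP; split; first exact: star_finS.
move=> x Ex; have [->|x0] := eqVneq x 0; first exact: fbar0.
have CE : fbar_scale x0 (colon E [:: x]) `<=` E.
  by move=> _ [d [_ /(_ x)] + <-]; rewrite mem_head mulrC; apply.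
apply: (semistarS CE); rewrite semistarZ; exists 1; last by rewrite mulr1.
have [|F [Ff FC] F1] := @star_tilde_colon star E [:: x].
  by move=> y; rewrite inE => /eqP ->.
exists F => //; apply/star_tilde_unitP; last by rewrite star_fin_fg.
by move=> y /FC[].
Qed.

Lemma Pi_tilde star : Pi (star_tilde star) = Pi (star_fin star).
Proof.
apply/seteqP; split=> P /PiP[Pp P1]; apply/PiP; split=> //;
  by move=> /star_tilde_unitP H; apply: P1; apply: H; case: Pp.
Qed.

Lemma star_sp_tilde star : star_sp (star_tilde star) = star_tilde star.
Proof.
by apply: semistarP => E /=; rewrite /sp_set Pi_tilde.
Qed.

Lemma quasi_max_tilde star : quasi_max (star_fin star) = quasi_max (star_tilde star).
Proof.
apply/seteqP; split=> M /quasi_maxP[MD M1 Mmax]; apply/quasi_maxP; split=> //.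
- by move=> /star_tilde_unitP; auto.
- by move=> J JD J1; apply: Mmax => // /star_tilde_unitP; auto.
- by move=> /star_tilde_unitP; auto.
- by move=> J JD J1; apply: Mmax => // /star_tilde_unitP; auto.
Qed.

End Tilde.

(** * Contents and Nagata rings *)

Section Nagata.
Variables (K : fieldType) (R : subdomain K).
Implicit Types (f g h : {poly K}) (s : seq K).

Lemma poly_overP h : poly_over R h <-> forall i, R h`_i.
Proof.
split=> [/allP hR i|hR]; last by apply/(all_nthP 0) => i _; rewrite inE.
have [ih|ih] := ltnP i (size h); last by rewrite nth_default //; exact: dom0.
by have := hR _ (mem_nth 0 ih); rewrite inE.
Qed.

Lemma content_min h (h0 : h != 0) (E : fbar R) :
  (forall i, E h`_i) -> content R h0 `<=` E.
Proof. by move=> hE; apply: span_min => _ /(nthP 0)[i _ <-]. Qed.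

Lemma content_coef h (h0 : h != 0) i : content R h0 h`_i.
Proof.
have [ih|ih] := ltnP i (size h); last by rewrite nth_default //; exact: fbar0.
by apply: sub_span; rewrite /= mem_nth.
Qed.

Lemma content_ideal h (h0 : h != 0) : poly_over R h -> is_ideal (content R h0).
Proof. by move=> /poly_overP hR; apply: (@content_min _ _ (fbar_dom R)). Qed.

Lemma content_fg h (h0 : h != 0) : fin_gen (content R h0).
Proof. by exists h. Qed.

(** An ideal has the same closure as the ring exactly when this closure
contains 1. *)
Lemma NaP (star : semistar R) q : Na star q <->
  exists f g (g0 : g != 0), [/\ poly_over R f, poly_over R g,
    star (content R g0) 1 & q = tofrac f / tofrac g].
Proof.
split=> -[f [g [g0 [fR gR cg ->]]]]; exists f, g, g0; split=> //;
  by apply/star_eq_domP => //; apply: content_ideal.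
Qed.

End Nagata.

Section Spread.
Variable K : fieldType.
Implicit Types (f g h : {poly K}) (s : seq K).

(** The sum of the s_k X^(k N). *)
Definition spread N s : {poly K} := foldr (fun a h => h * 'X^N + a%:P) 0 s.

Lemma spread_coef N s (A : set K) : A 0 ->
  (forall a b, A a -> A b -> A (a + b)) -> [set` s] `<=` A ->
  forall i, A (spread N s)`_i.
Proof.
move=> A0 AD; elim: s => [|a s IH] sA i; first by rewrite coef0.
rewrite coefD coefMXn coefC; apply: AD; case: ifP => // _.
  by apply: IH => x xs; apply: sA; rewrite /= inE (xs : x \in s) orbT.
by apply: sA; rewrite /= mem_head.
Qed.

(** The shifted copies a_k g X^(k N) of g do not overlap, so every product of
coefficients survives as a coefficient. This replaces the Dedekind-Mertens
or Gauss lemma. *)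
Lemma spread_coefM N s g a i : (size g <= N)%N -> a \in s ->
  exists j, (spread N s * g)`_j = a * g`_i.
Proof.
move=> gN; elim: s => [//|b s IH]; rewrite inE => as_.
have [iN|Ni] := ltnP i N; last first.
  exists (size (spread N (b :: s) * g)).
  by rewrite !nth_default ?mulr0 //; apply: leq_trans Ni.
rewrite /= mulrDl mulrAC mul_polyC.
have [->|ab] := eqVneq a b.
  by exists i; rewrite coefD coefMXn iN coefZ add0r.
have [|j <-] := IH; first by case/orP: as_ ab => // /eqP ->; rewrite eqxx.
exists (j + N)%N; rewrite coefD coefMXn ltnNge leq_addl addnK coefZ.
by rewrite [g`__]nth_default ?mulr0 ?addr0 // (leq_trans gN) ?leq_addl.
Qed.

End Spread.

Section NagataTilde.
Variables (K : fieldType) (D : subdomain K) (star : semistar D).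

Lemma Na_tilde : Na star = Na (star_tilde star).
Proof.
apply/seteqP; split=> q /NaP[f [g [g0 [fD gD cg ->]]]];
  apply/NaP; exists f, g, g0; split=> //.
  apply/star_tilde_unitP; first exact: content_ideal.
  by rewrite star_fin_fg //; exact: content_fg.
rewrite -star_fin_fg; last exact: content_fg.
by apply/star_tilde_unitP => //; exact: content_ideal.
Qed.

(** Clearing the denominators of f and g with a polynomial whose content is a
unit keeps the fraction f / g and makes its numerator and denominator
polynomials over D. *)
Lemma Na_overring :
  Na (star_tilde star) = Na (star_dot (star_tilde star)).
Proof.
apply/seteqP; split=> q /NaP[f [g [g0 [fD gD cg ->]]]]; apply/NaP.
  have sR (p : {poly K}) : poly_over D p -> poly_over (overring (star_tilde star)) p.
    by move=> /poly_overP pD; apply/poly_overP => i; apply: semistar_ext; apply: pD.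
  exists f, g, g0; split=> //; [exact: sR|exact: sR|].
  apply: (@semistarS _ _ (star_tilde star) _ (restrict (content _ g0))) cg.
  by apply: content_min => i; exact: content_coef.
(* All coefficients of f and g lie in the closure of D, so their common
   conductor to D is a unit; H witnesses this. *)
have [|H [[s Hs] HC] H1] := @star_tilde_colon _ _ star (fbar_dom D) (f ++ g).
  by move=> y; rewrite mem_cat => /orP[]/(nthP 0)[i _ <-];
    [move/poly_overP: fD|move/poly_overP: gD]; apply.
pose h := spread (size g) s.
have Hh i : H h`_i.
  apply: spread_coef; [exact: fbar0|exact: fbarD|].
  by rewrite Hs; apply: sub_span.
have Dhp (p : {poly K}) : {subset (p : seq K) <= f ++ g} -> poly_over D (h * p).
  move=> pfg; apply/poly_overP => i; rewrite coefM.
  apply: (@fbar_sum _ _ (fbar_dom D)) => j _ /=.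
  have [pj|pj] := ltnP (i - j) (size p).
    by have [_] := HC _ (Hh j); apply; apply: pfg; exact: mem_nth.
  by rewrite [p`_ _]nth_default // mulr0; exact: dom0.
have Dhf : poly_over D (h * f) by apply: Dhp => y yf; rewrite mem_cat yf.
have Dhg : poly_over D (h * g) by apply: Dhp => y yg; rewrite mem_cat yg orbT.
have h0 : h != 0.
  have [x Hx x0] := fbar_neq0 H.
  have [a as_ a0] : exists2 a, a \in s & a != 0.
    apply: contrapT => s0; case/eqP: x0.
    move: Hx; rewrite Hs => -[r Hr ->]; rewrite big_seq big1 // => p /Hr[ps _].
    have [->|p0] := eqVneq p.1 0; first by rewrite mul0r.
    by case: s0; exists p.1.
  have [j hgj] := spread_coefM (size g).-1 (leqnn (size g)) as_.
  apply: contra_neq (mulf_neq0 a0 (_ : lead_coef g != 0)).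
    by move=> h_0; rewrite /lead_coef -hgj -/h h_0 mul0r coef0.
  by rewrite lead_coef_eq0.
have hg0 : h * g != 0 by rewrite mulf_neq0.
exists (h * f), (h * g), hg0; split=> //; last first.
  by rewrite !tofracM invfM mulrACA divff ?mul1r // tofrac_eq0.
apply/star_tilde_unitP; first exact: content_ideal.
apply: star_fin_unit => [|P SP cP]; first exact: content_ideal.
have /PiP[Pp P1] := SP; have [_ _ PM] := Pp.
(* A generator a of H outside P; then all a g_i lie in P if h g does. *)
have [a as_ Pa] : exists2 a, a \in s & ~ P a.
  apply: contrapT => sP; apply: P1; exists H => //; split; first by exists s.
  rewrite Hs; apply: span_min => a as_; apply: contrapT => Pa.
  by apply: sP; exists a.
have Da : D a.
  by have [] : colon (fbar_dom D) (f ++ g) a by apply: HC; rewrite Hs; apply: sub_span.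
(* The content of g over the overring contains some t outside P; it is
   generated by the g_i, with coefficients that lie in D_P. *)
have [t [Dt Pt gt]] := (setmul_localizationP _ 1 Pp).1 (cg P SP).
rewrite mulr1 in gt.
(* Since the a g_i lie in P, a t lies in P D_P, though neither a nor t is in P. *)
have : setmul P (localization P) (a * t).
  case: gt => r Hr ->; rewrite mulr_sumr big_seq.
  apply: (big_ind (fun y => setmul P (localization P) y)).
  - exact: setmul0.
  - by move=> *; apply: setmulD.
  - move=> p /Hr[/= /(nthP 0)[i _ <-] Rp]; rewrite mulrA; apply: setmul_mem.
      have [j <-] := spread_coefM i (leqnn (size g)) as_.
      by apply: cP; exact: content_coef.
    have [u [Du Pu Dup]] := (setmul_localizationP _ _ Pp).1 (Rp P SP).
    have u0 : u != 0 by apply: contra_not_neq Pu => ->; exact: fbar0.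
    by exists (u * p.2), u; split=> //; rewrite mulrAC divff ?mul1r.
move=> /(setmul_localizationP _ _ Pp)[u [Du Pu]].
have Dat : D (a * t) by exact: domM.
by case/(PM _ _ Du Dat) => // /(PM _ _ Da Dt)[].
Qed.

End NagataTilde.

Theorem corollary3p5 (K : fieldType) (D : subdomain K) (star : semistar D)
    (nontriv : nontrivial star) :
  [/\ [/\ star_fin (star_tilde star) = star_tilde star,
          star_tilde star = star_sp (star_tilde star) &
          star_sp (star_tilde star) = star_tilde (star_tilde star)],
      quasi_max (star_fin star) = quasi_max (star_tilde star) &
      Na star = Na (star_tilde star) /\
      Na (star_tilde star) = Na (star_dot (star_tilde star))].
Proof.
split; [split|exact: quasi_max_tilde|split; [exact: Na_tilde|exact: Na_overring]].
- exact: star_tilde_fin_type.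
- by rewrite star_sp_tilde.
- by rewrite [RHS]/star_tilde star_tilde_fin_type.
Qed.
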